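(* Let $m$ and $p$ be integers with $1\le p\le m$. Then: (1) $1\le s_{\mathbb R}(m,p)\le p$, and $s_{\mathbb R}(m,p)=p$ if and only if $p=1$ or $p=m-1$ or $p=m$. (2) $s_{\mathbb R}(m,p)$ increases (weakly) as $p$ increases and decreases (weakly) as $m$ increases; that is, $s_{\mathbb R}(m,p)\le s_{\mathbb R}(m,p')$ whenever $p\le p'\le m$, and $s_{\mathbb R}(m,p)\ge s_{\mathbb R}(m',p)$ whenever $m\le m'$. (3) If $m-p$ is even, then $s_{\mathbb R}(m,p)=s_{\mathbb R}(m+1,p)$. (4) For every integer $m\ge 3$, $s_{\mathbb R}(m+1,m-2)=s_{\mathbb R}(m,m-2)=[\,m-\log_2(m+1)\,]$.
   Context: Let $D^1=[-1,1]\subset\mathbb R$ and $S^0=\{\pm1\}$, a group under multiplication. The 2-torus $(S^0)^m$ acts on $(D^1)^m$ by coordinatewise multiplication. For integers $0\le p\le m$, $m\ge 1$, let $X_{m,p}\subset (D^1)^m$ be the set of points $(x_1,\dots,x_m)\in (D^1)^m$ such that at least $p$ of the coordinates lie in $S^0$ (i.e. the union, over all choices of $m-p$ coordinate positions, of the products with $D^1$ in those positions and $S^0$ in the remaining $p$ positions). This is the real moment-angle complex of the $(m-p-1)$-skeleton of the $(m-1)$-simplex, and it is invariant under $(S^0)^m$. The invariant $s_{\mathbb R}(m,p)$ is the maximum integer $k$ for which there is a subgroup of $(S^0)^m$ isomorphic to $(\mathbb Z/2)^k$ that acts freely on $X_{m,p}$. For a real number $r$, $[r]$ denotes the greatest integer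 less than or equal to $r$. *)

(* Defs.v *)
From HB Require Import structures.
From mathcomp Require Import all_boot all_order all_algebra all_fingroup.
From mathcomp Require Import all_classical all_reals all_analysis.

Set Implicit Arguments.
Unset Strict Implicit.
Unset Printing Implicit Defensive.

Import Order.TTheory GRing.Theory Num.Theory.
Local Open Scope ring_scope.

Definition in_S0 (R : realType) (x : R) : bool := (x == 1) || (x == -1).

Record S0 (R : realType) := MkS0 { S0val :> R; S0valP : in_S0 S0val }.

HB.instance Definition _ (R : realType) := [isSub for @S0val R].
HB.instance Definition _ (R : realType) := [Choice of S0 R by <:].

Section SphereGroup.
Variable R : realType.
Implicit Types a b c : S0 R.

Lemma S0_1 : in_S0 (1 : R).
Proof. by rewrite /in_S0 eqxx. Qed.

Lemma S0_N1 : in_S0 (-1 : R).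
Proof. by rewrite /in_S0 eqxx orbT. Qed.

Lemma S0_M a b : in_S0 (S0val a * S0val b).
Proof.
case: a b => x xP [y yP] /=; rewrite /in_S0 in xP yP *.
by case/orP: xP => /eqP->; case/orP: yP => /eqP->;
  rewrite ?mul1r ?mulr1 ?mulrNN ?mulr1 eqxx ?orbT.
Qed.

Definition S0_of_bool (b : bool) : S0 R := if b then MkS0 S0_N1 else MkS0 S0_1.

Lemma S0_of_boolK : cancel (fun a => S0val a == -1) S0_of_bool.
Proof.
move=> [x xP]; apply: val_inj => /=; have [->//|xN1 /=] := eqVneq x (-1).
by move: xP; rewrite /in_S0 (negbTE xN1) orbF => /eqP.
Qed.

HB.instance Definition _ :=
  Choice_isCountable.Build (S0 R) (pcan_pickleK (can_pcan S0_of_boolK)).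

Lemma S0_enumP : Finite.axiom [:: S0_of_bool false; S0_of_bool true].
Proof.
move=> [x xP] /=; rewrite -!val_eqE /= addn0.
have N11 : (-1 == 1 :> R) = false.
  by rewrite -subr_eq0 -opprD oppr_eq0 -(natrD _ 1 1) pnatr_eq0.
by move: xP; rewrite /in_S0 => /orP[]/eqP->; rewrite eqxx // ?N11 // eq_sym N11.
Qed.

HB.instance Definition _ := fintype.isFinite.Build (S0 R) S0_enumP.

Definition S0one : S0 R := MkS0 S0_1.
Definition S0mul a b : S0 R := MkS0 (S0_M a b).

Lemma S0mulA : associative S0mul.
Proof. by move=> a b c; apply: val_inj; rewrite /= mulrA. Qed.

Lemma S0mul1 : left_id S0one S0mul.
Proof. by move=> a; apply: val_inj; rewrite /= mul1r. Qed.

Lemma S0mulV : left_inverse S0one id S0mul.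
Proof.
move=> [x xP]; apply: val_inj => /=.
by move: xP; rewrite /in_S0 => /orP[]/eqP->; rewrite ?mulrNN mulr1.
Qed.

HB.instance Definition _ := Finite_isGroup.Build (S0 R) S0mulA S0mul1 S0mulV.

End SphereGroup.

(* The 2-torus (S^0)^m, with the direct product group structure. *)
Definition torus2 (R : realType) (m : nat) : finGroupType :=
  {dffun forall _ : 'I_m, S0 R}.

Definition torus2_act (R : realType) (m : nat) (x : 'rV[R]_m) (g : torus2 R m) :
  'rV[R]_m := \row_i (S0val (g i) * x 0 i).

Lemma torus2_act1 (R : realType) (m : nat) (x : 'rV[R]_m) :
  torus2_act x 1%g = x.
Proof. by apply/rowP => i; rewrite mxE ffunE /= mul1r. Qed.

Lemma torus2_actM (R : realType) (m : nat) (x : 'rV[R]_m) (g h : torus2 R m) :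
  torus2_act x (g * h)%g = torus2_act (torus2_act x g) h.
Proof. by apply/rowP => i; rewrite !mxE ffunE /= mulrA (mulrC (S0val (g i))). Qed.

Definition torus2_action (R : realType) (m : nat) :
    {action torus2 R m &-> 'rV[R]_m} :=
  TotalAction (@torus2_act1 R m) (@torus2_actM R m).

(* The points of (D^1)^m with at least p coordinates in S^0. *)
Definition Xspace (R : realType) (m p : nat) : set 'rV[R]_m :=
  [set x | (forall i, -1 <= x 0 i <= 1) /\
           (p <= #|[pred i | in_S0 (x 0%R i)]|)%N]%classic.

Arguments Xspace : clear implicits.

Lemma in_S0M (R : realType) (a : S0 R) (x : R) : in_S0 (S0val a * x) = in_S0 x.
Proof.
case/orP: (S0valP a) => /eqP->; first by rewrite mul1r.
by rewrite /in_S0 mulN1r eqr_opp eqr_oppLR orbC.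
Qed.

Lemma Xspace_invariant (R : realType) (m p : nat) (x : 'rV[R]_m)
  (g : torus2 R m) : Xspace R m p x -> Xspace R m p (torus2_action R m x g).
Proof.
case=> xD xp; split=> [i|].
  rewrite mxE -ler_norml normrM; by case/orP: (S0valP (g i)) => /eqP->;
    rewrite ?normrN normr1 mul1r ler_norml.
apply: (leq_trans xp); apply/eq_leq/eq_card => i.
by rewrite !inE mxE in_S0M.
Qed.

Definition acts_freely_on (aT : finGroupType) (T : Type)
    (to : {action aT &-> T}) (H : {set aT}) (X : set T) : Prop :=
  forall (g : aT) (x : T), g \in H -> X x -> to x g = x -> g = 1%g.

(* Some subgroup of (S^0)^m isomorphic to (Z/2)^k acts freely on X_{m,p};
   matrices carry the additive group structure, and Z/2 is 'Z_2. *)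
Definition free_rank (R : realType) (m p k : nat) : Prop :=
  exists H : {group torus2 R m},
    H \isog [set: 'rV['Z_2]_k] /\
    acts_freely_on (torus2_action R m) H (Xspace R m p).

Lemma free_rank_ex (R : realType) (m p : nat) : exists k, `[< free_rank R m p k >].
Proof.
exists 0%N; apply/asboolP; exists 1%G; split; last by move=> g x /set1P.
apply: trivial_isog => //.
by apply/setP => v; rewrite !inE; apply/esym/eqP; apply/rowP; case.
Qed.

Lemma free_rank_le (R : realType) (m p k : nat) :
  `[< free_rank R m p k >] -> (k <= m)%N.
Proof.
move=> /asboolP[H [/card_isog cH _]].
have cS0 : #|{: S0 R}| = 2%N by rewrite cardE enumT unlock.
have : (#|H| <= #|torus2 R m|)%N by exact: max_card.
have -> : #|torus2 R m| = (2 ^ m)%N.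
  by rewrite card_dep_ffun foldrE big_map big_enum /= prod_nat_const card_ord cS0.
by rewrite cH cardsT card_mx card_ord mul1n leq_exp2l.
Qed.

Definition s_R (R : realType) (m p : nat) : nat :=
  ex_maxn (free_rank_ex R m p) (@free_rank_le R m p).

Definition log2 (R : realType) (x : R) : R := ln x / ln 2.

(* Main.v *)
(** An element [g] of the 2-torus fixes a point of [Xspace R m p] exactly when at
    most [m - p] of its coordinates are [-1]. Hence [s_R R m p] is the largest
    dimension of a binary linear code of length [m] and minimum distance at least
    [m - p + 1]. The Singleton bound and the absence of nontrivial binary MDS
    codes give (1), puncturing gives (2), adding a parity bit to a code of odd
    distance gives (3), and the Hamming bound, attained up to integer part by
    shortened Hamming codes, gives (4). *)

Require Import Defs.
From mathcomp Require Import all_boot all_order all_algebra all_fingroup.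
From mathcomp Require Import all_classical all_reals all_analysis.
From mathcomp Require Import zify.

Import Order.TTheory GRing.Theory Num.Theory.
Local Open Scope ring_scope.

(** * Arithmetic in ['F_2] and Hamming weight *)

Definition hweight {m : nat} (v : 'rV['F_2]_m) : nat :=
  (\sum_(i < m) (v 0%R i != 0%R))%N.

(* Over [F_2] an additive map is linear, so [f] is the encoding map of
   a linear code. *)
Definition binary_code (m k d : nat) : Prop :=
  exists f : 'rV['F_2]_k -> 'rV['F_2]_m,
    {morph f : u v / u - v} /\ forall u, u != 0 -> (d <= hweight (f u))%N.

Lemma F2_neq0 (a : 'F_2) : a != 0 -> a = 1.
Proof. by case: a => [[|[|]]] // i _; apply/val_inj. Qed.

Lemma F2_eq_neq0 (a : 'F_2) : a = (a != 0)%:R.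
Proof. by have [->|/F2_neq0] := eqVneq a 0. Qed.

Lemma F2_natr_neq0 (n : nat) : (n%:R != 0 :> 'F_2) = odd n.
Proof.
rewrite -[n in LHS]odd_double_half natrD -muln2 natrM.
have -> : (2%:R : 'F_2) = 0 by apply/val_inj.
by rewrite mulr0 addr0; case: (odd n).
Qed.

Lemma oppF2_row n (v : 'rV['F_2]_n) : - v = v.
Proof. by apply/rowP => i; rewrite mxE [v 0 i]F2_eq_neq0; case: eqP => _; apply/val_inj. Qed.

Lemma morphB0 (U V : zmodType) (f : U -> V) : {morph f : u v / u - v} -> f 0 = 0.
Proof. by move=> fB; rewrite -[X in f X](subr0 (0 : U)) fB subrr. Qed.

Section HammingWeight.
Variable m : nat.
Implicit Types u v : 'rV['F_2]_m.

Lemma hweightE v : hweight v = #|[pred i | v 0 i != 0]|.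
Proof. by rewrite /hweight -sum1_card [RHS]big_mkcond /=; apply: eq_bigr => i _; rewrite inE; case: eqP. Qed.

Lemma hweight0 : hweight (0 : 'rV_m) = 0%N.
Proof. by rewrite /hweight big1 // => i _; rewrite mxE eqxx. Qed.

Lemma hweightB u v : (hweight (u - v)%R <= hweight u + hweight v)%N.
Proof.
rewrite /hweight -big_split leq_sum // => i _; rewrite !mxE.
by case: (eqVneq (u 0 i) 0) => [->|_]; [rewrite sub0r oppr_eq0|case: eqP].
Qed.

Lemma hweight_delta (i : 'I_m) : hweight (delta_mx 0 i) = 1%N.
Proof.
rewrite /hweight (bigD1 i) //= mxE !eqxx big1 // => j ji.
by rewrite mxE (negbTE ji) andbF.
Qed.

Lemma hweight_le v : (hweight v <= m)%N.
Proof. by rewrite hweightE; apply: leq_trans (max_card _) _; rewrite card_ord. Qed.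

Lemma hweight_full v : (m <= hweight v)%N -> v = const_mx 1.
Proof.
move=> h; have e : #|[pred i | v 0 i != 0]| = #|'I_m|.
  by rewrite -hweightE card_ord; apply/eqP; rewrite eqn_leq hweight_le.
apply/rowP => i; rewrite mxE; apply: F2_neq0.
by have := subset_cardP e (subset_predT _) i; rewrite !inE.
Qed.

Lemma sum_row_hweight v : \sum_i v 0 i = (hweight v)%:R.
Proof. by rewrite /hweight natr_sum; apply: eq_bigr => i _; exact: F2_eq_neq0. Qed.

End HammingWeight.

Lemma hweight_row_mx m n (u : 'rV['F_2]_m) (v : 'rV['F_2]_n) :
  hweight (row_mx u v) = (hweight u + hweight v)%N.
Proof.
rewrite /hweight big_split_ord; congr (_ + _)%N; apply: eq_bigr => i _.
  by rewrite row_mxEl.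
by rewrite row_mxEr.
Qed.

Lemma hweight_submx m n (v : 'rV['F_2]_(m + n)) :
  hweight v = (hweight (lsubmx v) + hweight (rsubmx v))%N.
Proof. by rewrite -hweight_row_mx hsubmxK. Qed.

(** A nonzero difference [u - v] is encoded with weight at least [d], while additivity puts its
    codeword in the kernel of [h], where weights stay below [d]. Taking [h] to be the identity gives
    injectivity of [f] itself. *)
Lemma code_inj m k d n (f : 'rV['F_2]_k -> 'rV['F_2]_m)
    (h : 'rV['F_2]_m -> 'rV['F_2]_n) :
  {morph f : u v / u - v} -> {morph h : u v / u - v} ->
  (forall u, u != 0 -> (d <= hweight (f u))%N) ->
  (forall v, h v = 0 -> (hweight v < d)%N) -> injective (h \o f).
Proof.
move=> fB hB fd hd u v /= /eqP; rewrite -subr_eq0 -hB -fB => /eqP/hd.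
move=> lt; apply/eqP; rewrite -subr_eq0; apply: contraTT lt => /fd.
by rewrite -leqNgt.
Qed.

Lemma card_F2_row n : #|{: 'rV['F_2]_n}| = (2 ^ n)%N.
Proof. by rewrite card_mx card_ord mul1n. Qed.

Lemma lsubmxB (m n : nat) : {morph @lsubmx 'F_2 1 m n : u v / u - v}.
Proof. by move=> u v; apply/rowP => i; rewrite !mxE. Qed.

Lemma rsubmxB (m n : nat) : {morph @rsubmx 'F_2 1 m n : u v / u - v}.
Proof. by move=> u v; apply/rowP => i; rewrite !mxE. Qed.

(** A word vanishing on its first [p] coordinates has weight at most [r]. *)
Lemma lsubmx_code_inj k p r (f : 'rV['F_2]_k -> 'rV['F_2]_(p + r)) :
  {morph f : u v / u - v} -> (forall u, u != 0 -> (r < hweight (f u))%N) ->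
  injective (lsubmx \o f).
Proof.
move=> fB fd; apply: (code_inj _ _ _ _ _ _ fB (lsubmxB p r) fd) => v v0.
by rewrite hweight_submx v0 hweight0 add0n ltnS hweight_le.
Qed.

(** * Bounds and constructions for binary codes *)

Lemma binary_code_singleton m p k :
  (p <= m)%N -> binary_code m k (m - p).+1 -> (k <= p)%N.
Proof.
move=> /subnKC; set r := (m - p)%N; move: r => r <- [f [fB fd]].
have /leq_card := lsubmx_code_inj _ _ _ _ fB fd.
by rewrite !card_F2_row leq_exp2l.
Qed.

(* In a binary code meeting the Singleton bound, the words whose first [p]
   coordinates are [e_0] and [e_1] are both 1 on all other coordinates, so
   their difference has weight 2. *)
Lemma binary_code_mds m p :
  (2 <= p)%N -> (p + 2 <= m)%N -> ~ binary_code m p (m - p).+1.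
Proof.
move=> p2 pm; have := subnKC (leq_trans (leq_addr 2 p) pm).
have r2 : (2 <= m - p)%N by lia.
move: r2; set r := (m - p)%N; move: r => r r2 e; rewrite -{}e {pm} => -[f [fB fd]].
have finj := lsubmx_code_inj _ _ _ _ fB fd.
(* Source and target both have dimension [p], so injectivity gives bijectivity: [g] finds the
   message whose codeword has prescribed first [p] coordinates. *)
have [g _ fg] := injF_bij finj.
pose i0 : 'I_p := Ordinal (ltnW p2); pose i1 : 'I_p := Ordinal p2.
have rsub i : rsubmx (f (g (delta_mx 0 i))) = const_mx 1.
  apply: hweight_full; have := fd (g (delta_mx 0 i)).
  rewrite hweight_submx [lsubmx _]fg hweight_delta add1n ltnS; apply.
  apply/eqP => g0; have := fg (delta_mx 0 i).
  rewrite g0 /= (morphB0 _ _ _ fB) linear0 => /rowP/(_ i).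
  by rewrite !mxE !eqxx => /eqP; rewrite eq_sym oner_eq0.
have ne : g (delta_mx 0 i0) - g (delta_mx 0 i1) != 0.
  rewrite subr_eq0; apply/eqP => /(can_inj fg)/rowP/(_ i0).
  by rewrite !mxE !eqxx.
have := fd _ ne; rewrite hweight_submx fB lsubmxB rsubmxB !rsub subrr hweight0 addn0.
rewrite ![lsubmx _]fg => lt; have := leq_trans lt (hweightB _ _ _).
by rewrite !hweight_delta; lia.
Qed.

Lemma binary_code_weaken m k d d' :
  (d' <= d)%N -> binary_code m k d -> binary_code m k d'.
Proof. by move=> dd [f [fB fd]]; exists f; split=> // u /fd; apply: leq_trans. Qed.

Lemma binary_code_id m : binary_code m m 1.
Proof.
exists id; split=> // u u0; rewrite lt0n; apply: contra u0.
rewrite /hweight sum_nat_eq0 => /forallP h; apply/eqP/rowP => i; rewrite mxE.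
by have := h i; rewrite eqb0 negbK => /eqP.
Qed.

Lemma binary_code_repetition m : binary_code m 1 m.
Proof.
exists (fun u => const_mx (u 0 0)); split=> [u v|u u0].
  by apply/rowP => i; rewrite !mxE.
have /F2_neq0 -> : u 0 0 != 0.
  by apply: contra u0 => /eqP u0; apply/eqP/rowP => i; rewrite ord1 u0 mxE.
rewrite /hweight (eq_bigr (fun=> 1%N)) => [|i _]; first by rewrite sum1_card card_ord.
by rewrite mxE oner_eq0.
Qed.

(** Deleting [r] coordinates lowers a weight by at most [r]. *)
Lemma binary_code_puncture m r k d :
  binary_code (m + r) k (d + r) -> binary_code m k d.
Proof.
move=> [f [fB fd]]; exists (lsubmx \o f); split=> [u v|u /fd] /=.
  by rewrite fB lsubmxB.
by rewrite hweight_submx => h; have := hweight_le _ (rsubmx (f u)); lia.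
Qed.

(** The appended sum of coordinates is nonzero exactly on words of odd weight. These gain one, and
    an even weight that is at least the odd [d] already exceeds it. *)
Lemma binary_code_parity m k d :
  odd d -> binary_code m k d -> binary_code m.+1 k d.+1.
Proof.
move=> d_odd [f [fB fd]]; rewrite -addn1.
exists (fun u => row_mx (f u) (const_mx (\sum_i f u 0 i))); split=> [u v|u /fd h].
  rewrite opp_row_mx add_row_mx fB; congr row_mx; apply/rowP => i; rewrite !mxE.
  by rewrite -sumrB; apply: eq_bigr => j _; rewrite !mxE.
rewrite hweight_row_mx {2}/hweight big_ord1 mxE sum_row_hweight F2_natr_neq0.
by case: (boolP (odd _)) => /= o; [rewrite addn1|move: h o d_odd; lia].
Qed.

(** Sphere packing: the radius-1 balls around codewords are disjoint, and each has [n.+1]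
    elements. *)
Lemma binary_code_hamming_bound n k :
  binary_code n k 3 -> (2 ^ k * n.+1 <= 2 ^ n)%N.
Proof.
move=> [f [fB fd]].
(* The error patterns of weight at most 1: [None] stands for no error, [Some i] for an error at
   [i]. *)
pose e (o : option 'I_n) : 'rV['F_2]_n := if o is Some i then delta_mx 0 i else 0.
have we o : (hweight (e o) <= 1)%N.
  by case: o => [i|]; rewrite /= ?hweight_delta ?hweight0.
have e_inj : injective e.
  have d0 (i : 'I_n) : delta_mx (0 : 'I_1) i != 0 :> 'rV['F_2]_n.
    by apply/eqP => h; have := hweight_delta _ i; rewrite h hweight0.
  move=> [i|] [j|] //= => [/rowP/(_ i)|/eqP|/esym/eqP]; rewrite ?(negPf (d0 _)) //.
  by rewrite !mxE !eqxx; case: (eqVneq i j) => [->|].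
suff /leq_card : injective (fun x : 'rV['F_2]_k * option 'I_n => f x.1 + e x.2).
  by rewrite card_prod card_option card_ord !card_F2_row.
move=> [u o] [v o'] /= h.
have fuv : f (u - v) = e o' - e o.
  by rewrite fB; apply/eqP; rewrite subr_eq addrAC eq_sym subr_eq addrC h addrC.
have uv : u = v.
  apply/eqP; rewrite -subr_eq0; apply/negPn/negP => /fd; rewrite fuv => lt.
  have := leq_trans lt (hweightB _ _ _); have := we o; have := we o'; lia.
by move: h; rewrite uv => /addrI/e_inj ->.
Qed.

(* The kernel of a parity check matrix with distinct nonzero rows contains no
   vector of weight 1 or 2. *)
Lemma binary_code_hamming n r :
  (n < 2 ^ r)%N -> exists2 k, (n - r <= k)%N & binary_code n k 3.
Proof.
move=> nr; have cD : (n <= #|[set~ (0%R : 'rV['F_2]_r)]|)%N.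
  by have := cardsC1 (0 : 'rV['F_2]_r); rewrite card_F2_row; lia.
pose h (i : 'I_n) : 'rV['F_2]_r := enum_val (widen_ord cD i).
have h_inj : injective h by move=> i j /enum_val_inj/(congr1 val) /= /val_inj.
have h0 i : h i != 0 by have := enum_valP (widen_ord cD i); rewrite !inE.
pose H : 'M['F_2]_(n, r) := \matrix_(i, j) h i 0 j.
(* The message is the coordinate vector of a codeword in a basis of the kernel. *)
exists (\rank (kermx H)); first by rewrite mxrank_ker leq_sub2l // rank_leq_col.
exists (fun u => u *m row_base (kermx H)); split=> [u v|u u0].
  by rewrite mulmxBl.
set v := u *m _; have vH : v *m H = 0.
  apply/sub_kermxP; apply: (submx_trans (submxMl _ _)).
  by rewrite eq_row_base.
have v0 : v != 0.
  apply: contra u0 => /eqP v0.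
  have /row_free_inj inj := row_base_free (kermx H).
  by apply/eqP/inj; rewrite -/v v0 mul0mx.
clearbody v.
pose S := [set i | v 0 i != 0].
(* The equation [v *m H = 0] says that the rows of [H] indexed by the support of [v] sum to zero. *)
have sumS : \sum_(i in S) h i = 0.
  apply/rowP => j; rewrite -[RHS](congr1 (fun w : 'rV_r => w 0 j) vH) mxE summxE.
  rewrite big_mkcond /=; apply: eq_bigr => i _; rewrite mxE inE.
  by case: eqVneq => [->|/F2_neq0 ->]; rewrite ?mul0r ?mul1r.
have -> : hweight v = #|S| by rewrite hweightE; apply: eq_card => i; rewrite !inE.
rewrite ltnNge; apply/negP => S2.
have : #|S| \in [:: 0; 1; 2]%N by move: S2; case: #|S| => [|[|[|]]].
rewrite !inE => /or3P[|/cards1P[i Si]|/cards2P[i [j [ij Sij]]]].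
- move=> /eqP/cards0_eq S0; case/eqP: v0; apply/rowP => i.
  by have /setP/(_ i) := S0; rewrite !inE mxE => /negbT; rewrite negbK => /eqP.
- by move: sumS; rewrite Si big_set1 => /eqP; rewrite (negPf (h0 i)).
- move: sumS; rewrite Sij big_setU1 ?inE //= big_set1 => /eqP.
  by rewrite -[h j]oppF2_row subr_eq0 => /eqP/h_inj/eqP; rewrite (negPf ij).
Qed.

(** * Torus elements as binary words, with 1 in place of the sign -1 *)

Section FreeActions.
Variables (R : realType) (m : nat).
Implicit Types g : torus2 R m.

Lemma S0_neq1 (a : S0 R) : a != 1%g -> S0val a = -1.
Proof.
case: a => x xP; rewrite -val_eqE /= => x1.
by move: (xP); rewrite /in_S0 (negPf x1) => /eqP.
Qed.

Lemma N1_neq1 : (-1 == 1 :> R) = false.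
Proof. by rewrite -subr_eq0 -opprD oppr_eq0 -(natrD _ 1 1) pnatr_eq0. Qed.

Lemma S0_of_bool_eq1 b : (S0_of_bool R b == 1%g) = ~~ b.
Proof. by case: b; rewrite -val_eqE /= ?N1_neq1 ?eqxx. Qed.

Lemma S0_of_boolM b c :
  S0_of_bool R (b (+) c) = (S0_of_bool R b * S0_of_bool R c)%g.
Proof. by apply: val_inj; case: b c => [] [] /=; rewrite ?mulrNN ?mulr1 ?mul1r. Qed.

Definition row_of_torus g : 'rV['F_2]_m := \row_i (g i != 1%g)%:R.

Definition torus_of_row (v : 'rV['F_2]_m) : torus2 R m :=
  [ffun i => S0_of_bool R (v 0 i != 0)].

Lemma torus_of_rowD u v : torus_of_row (u + v) = (torus_of_row u * torus_of_row v)%g.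
Proof.
apply/ffunP => i; rewrite !ffunE !mxE -S0_of_boolM; congr S0_of_bool.
by case: (u 0 i) (v 0 i) => [[|[|]]] // ? [[|[|]]].
Qed.

Lemma torus_of_rowK : cancel torus_of_row row_of_torus.
Proof.
move=> v; apply/rowP => i; rewrite mxE ffunE S0_of_bool_eq1 negbK.
exact/esym/F2_eq_neq0.
Qed.

Lemma row_of_torusK : cancel row_of_torus torus_of_row.
Proof.
move=> g; apply/ffunP => i; rewrite !ffunE mxE.
have [->|gi] := eqVneq (g i) 1%g; first by apply: val_inj.
by apply: val_inj; rewrite /= (S0_neq1 _ gi).
Qed.

Lemma row_of_torusM g g' :
  row_of_torus (g * g')%g = row_of_torus g + row_of_torus g'.
Proof.
by apply: (can_inj torus_of_rowK); rewrite torus_of_rowD !row_of_torusK.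
Qed.

Lemma hweight_torus g : hweight (row_of_torus g) = #|[pred i | g i != 1%g]|.
Proof.
rewrite hweightE; apply: eq_card => i; rewrite !inE mxE.
by case: (g i != 1%g).
Qed.

Lemma torus_free_weight p g : (p <= m)%N ->
  (forall x, Xspace R m p x -> torus2_action R m x g = x -> g = 1%g) ->
  g != 1%g -> (m - p < hweight (row_of_torus g))%N.
Proof.
move=> pm free; apply: contraNT; rewrite -leqNgt hweight_torus => wg.
(* The point with 0 where [g] is -1 and 1 elsewhere is fixed by [g]; if the weight is at most
   [m - p], it lies in the space. *)
apply/eqP; pose x : 'rV[R]_m := \row_i (g i == 1%g)%:R.
apply: (free x); last first.
  apply/rowP => i; rewrite !mxE; case: eqP => [->|_]; last by rewrite mulr0.
  by rewrite mul1r.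
split=> [i|]; first
  by rewrite mxE; case: eqP; rewrite ?lexx ?lerN10 ?ler01 ?(le_trans (lerN10 R) ler01).
have cg : (#|[pred i | g i != 1%g]| + #|[predC [pred i | g i != 1%g]]| = m)%N.
  by rewrite cardC card_ord.
apply: (@leq_trans #|[predC [pred i | g i != 1%g]]|); first by move: wg cg; lia.
apply/subset_leq_card/fintype.subsetP => i; rewrite !inE mxE negbK => ->.
by rewrite /in_S0 eqxx.
Qed.

(** A fixed point vanishes wherever [g] is -1, so the support of [g] avoids its coordinates in the
    0-sphere, of which there are at least [p]. *)
Lemma torus_weight_free p g x : Xspace R m p x -> torus2_action R m x g = x ->
  (hweight (row_of_torus g) <= m - p)%N.
Proof.
move=> [_ px] /rowP gx; rewrite hweight_torus.
have cx : (#|[pred i | in_S0 (x 0%R i)]| + #|[predC [pred i | in_S0 (x 0%R i)]]| = m)%N.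
  by rewrite cardC card_ord.
apply: (@leq_trans #|[predC [pred i | in_S0 (x 0%R i)]]|); last first.
  by have : (p <= #|[pred i | in_S0 (x 0%R i)]|)%N := px; lia.
apply/subset_leq_card/fintype.subsetP => i; rewrite !inE => gi.
have := gx i; rewrite mxE (S0_neq1 _ gi) mulN1r => /eqP.
rewrite eq_sym -subr_eq0 opprK -mulr2n mulrn_eq0 /= => /eqP ->.
by rewrite /in_S0 eq_sym oner_eq0 eq_sym oppr_eq0 oner_eq0.
Qed.

End FreeActions.

(** An isomorphism onto a subgroup is an additive encoding map, and freeness says that every nonzero
    codeword has weight above [m - p]. *)
Lemma free_rankP (R : realType) (m p k : nat) : (p <= m)%N ->
  free_rank R m p k <-> binary_code m k (m - p).+1.
Proof.
move=> pm; split.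
  move=> [H [/isog_symr/isogP[f finj fH] free]].
  exists (fun u => row_of_torus R m (f u)); split=> [u v|u u0].
    rewrite oppF2_row [in RHS]oppF2_row -row_of_torusM; congr row_of_torus.
    by rewrite -morphM ?inE.
  have fuH : f u \in H by rewrite -fH mem_morphim ?inE.
  apply: torus_free_weight => // [x Xx|]; first exact: free.
  apply: contra u0 => /eqP fu1; apply/eqP; move/injmP: finj; apply; rewrite ?inE //.
  by rewrite fu1 -[0]FinRing.zmod1gE morph1.
move=> [f [fB fd]].
have fD : {morph f : u v / u + v}.
  by move=> u v; rewrite -[f v]oppF2_row -fB oppF2_row.
(* The types ['Z_2] and ['F_2] are convertible, so [f] accepts [u]. *)
pose F (u : 'rV['Z_2]_k) := torus_of_row R m (f u).
have FM : {in [set: 'rV['Z_2]_k] &, {morph F : x y / (x * y)%g}}.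
  move=> u v _ _; rewrite /F -torus_of_rowD FinRing.zmodMgE; congr torus_of_row.
  exact: fD.
pose Fm := Morphism FM.
exists (Fm @* [set: 'rV['Z_2]_k])%G; split.
  apply/isog_symr/sub_isog => //; apply/injmP => u v _ _ /(can_inj (@torus_of_rowK R m)).
  by apply: (code_inj _ _ _ _ _ id fB _ fd) => // w ->; rewrite hweight0.
move=> g x /morphimP[u _ _ ->] Xx gx.
have := torus_weight_free _ _ _ _ _ Xx gx.
rewrite torus_of_rowK leqNgt; have [->|/fd -> //] := eqVneq u 0.
by rewrite -[0]FinRing.zmod1gE morph1.
Qed.

(** * The invariant as a maximal code dimension *)

Section RealBuchstaberInvariant.
Variables (R : realType).

Lemma s_R_code m p : (p <= m)%N -> binary_code m (s_R R m p) (m - p).+1.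
Proof.
by move=> pm; apply/(free_rankP R); rewrite // /s_R; case: ex_maxnP => k /asboolP.
Qed.

Lemma s_R_max m p k : (p <= m)%N -> binary_code m k (m - p).+1 -> (k <= s_R R m p)%N.
Proof.
by move=> pm /(free_rankP R _ _ _ pm) h; rewrite /s_R; case: ex_maxnP => l _; apply; apply/asboolP.
Qed.

Lemma s_R_ge1 m p : (0 < p)%N -> (p <= m)%N -> (1 <= s_R R m p)%N.
Proof.
move=> p0 pm; apply: s_R_max => //.
by apply: binary_code_weaken (binary_code_repetition m); lia.
Qed.

Lemma s_R_le m p : (p <= m)%N -> (s_R R m p <= p)%N.
Proof. by move=> pm; apply: binary_code_singleton pm (s_R_code _ _ pm). Qed.

(** Equality means meeting the Singleton bound, which is excluded for [1 < p < m - 1]. The remaining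
    cases are realized by the repetition code, the even-weight code and the whole space. *)
Lemma s_R_eqP m p : (0 < p)%N -> (p <= m)%N ->
  s_R R m p = p <-> [\/ p = 1%N, p = (m - 1)%N | p = m].
Proof.
move=> p0 pm; have sp := s_R_le _ _ pm; split=> [e|h].
  have [p2|] := ltnP 1 p; last by move=> ?; apply: Or31; lia.
  have [pm2|] := leqP (p + 2) m; last first.
    by move=> ?; have [->|?] := eqVneq p m; [apply: Or33|apply: Or32; lia].
  by have := s_R_code _ _ pm; rewrite e => /binary_code_mds []; lia.
apply/eqP; rewrite eqn_leq sp /=; case: h => [p1|p1|->].
- by rewrite {1}p1 s_R_ge1.
- apply: s_R_max => //; have -> : (m = p.+1)%N by lia.
  by rewrite subSn // subnn; apply: binary_code_parity => //; exact: binary_code_id.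
- by apply: s_R_max => //; rewrite subnn; exact: binary_code_id.
Qed.

Lemma s_R_mono_p m p p' : (p <= p')%N -> (p' <= m)%N -> (s_R R m p <= s_R R m p')%N.
Proof.
move=> pp' p'm; apply: s_R_max => //.
by apply: binary_code_weaken (s_R_code _ _ (leq_trans pp' p'm)); lia.
Qed.

(** Puncturing [m' - m] coordinates lowers the length and the required distance by the same
    amount. *)
Lemma s_R_anti_m m m' p : (p <= m)%N -> (m <= m')%N -> (s_R R m' p <= s_R R m p)%N.
Proof.
move=> pm mm'; apply: s_R_max => //.
have := s_R_code _ _ (leq_trans pm mm'); move: (s_R R m' p) => k.
rewrite -(subnKC mm'); set r := (m' - m)%N => h; apply: (binary_code_puncture _ r).
by apply: binary_code_weaken h; lia.
Qed.

(** The required distance [(m - p).+1] is odd, so a parity bit raises it by one. *)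
Lemma s_R_even m p : (p <= m)%N -> ~~ odd (m - p) -> s_R R m p = s_R R m.+1 p.
Proof.
move=> pm ev; apply/eqP; rewrite eqn_leq; apply/andP; split; last exact: s_R_anti_m.
apply: s_R_max; first exact: leqW.
by rewrite subSn //; apply: binary_code_parity => //; exact: s_R_code.
Qed.

(** * Base-2 logarithms and the optimal dimension at distance 3 *)

Lemma ln2_gt0 : 0 < ln 2 :> R.
Proof. by rewrite ln_gt0 // ltr1n. Qed.

Lemma log2_natX (n : nat) : log2 ((2 ^ n)%:R : R) = n%:R.
Proof. by rewrite /log2 natrX lnXn // -[ln _ *+ n]mulr_natl mulfK // gt_eqF // ln2_gt0. Qed.

Lemma ler_log2_nat (a b : nat) : (0 < a)%N -> (0 < b)%N ->
  (log2 (a%:R : R) <= log2 b%:R) = (a <= b)%N.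
Proof.
move=> a0 b0; rewrite /log2 ler_pM2r ?invr_gt0 ?ln2_gt0 //.
by rewrite ler_ln ?posrE ?ltr0n // ler_nat.
Qed.

Lemma s_R_floor n : (3 <= n)%N ->
  (s_R R n (n - 2))%:Z = Num.floor (n%:R - log2 (n.+1%:R : R)).
Proof.
move=> n3; set s := s_R R n (n - 2); apply/esym/floor_def.
have n2 : (n - 2 <= n)%N by lia.
have d : (n - (n - 2)).+1 = 3%N by lia.
have bound : (2 ^ s * n.+1 <= 2 ^ n)%N.
  by apply: binary_code_hamming_bound; rewrite -d; exact: s_R_code.
have sn : (s < n)%N.
  by rewrite -(ltn_exp2l _ _ (isT : 1 < 2)%N); apply: leq_trans bound; have := expn_gt0 2 s; nia.
(* The redundancy [n - s] is positive; writing it as [r.+1] reduces the floor to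
   [2 ^ r < n.+1 <= 2 ^ r.+1]. *)
have [r nE] : exists r, n = (s + r.+1)%N by exists (n - s).-1; lia.
have up : (n.+1 <= 2 ^ r.+1)%N.
  by move: bound; rewrite {2}nE expnD leq_pmul2l // expn_gt0.
(* Otherwise a shortened Hamming code with [r] check bits would have dimension at least
   [n - r = s + 1], against the maximality of [s]. *)
have low : (2 ^ r < n.+1)%N.
  rewrite ltnNge; apply/negP => /binary_code_hamming[k rk ck].
  have : (k <= s)%N by apply: s_R_max => //; rewrite d.
  by lia.
have nR : n%:R = s%:R + r.+1%:R :> R by rewrite -natrD -nE.
move: up low; rewrite -ler_log2_nat ?expn_gt0 // ltnNge -ler_log2_nat ?expn_gt0 // -ltNge.
rewrite !log2_natX => up low; apply/andP; split.
  by rewrite -pmulrn nR -addrA lerDl subr_ge0.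
rewrite intrD -pmulrn nR mulr1z -addrA ltrD2l ltrBlDr.
by rewrite -natr1 addrC ltrD2l.
Qed.

End RealBuchstaberInvariant.

Theorem mainTheorem1 (R : realType) (m p : nat) (hp : (1 <= p)%N)
    (hpm : (p <= m)%N) :
  [/\ (1 <= s_R R m p <= p)%N /\
        (s_R R m p = p <-> [\/ p = 1%N, p = (m - 1)%N | p = m]),
      (forall p' : nat, (p <= p' <= m)%N -> (s_R R m p <= s_R R m p')%N) /\
        (forall m' : nat, (m <= m')%N -> (s_R R m' p <= s_R R m p)%N),
      ~~ odd (m - p) -> s_R R m p = s_R R m.+1 p
    & forall n : nat, (3 <= n)%N ->
        s_R R n.+1 (n - 2) = s_R R n (n - 2) /\
        (s_R R n (n - 2))%:Z = Num.floor (n%:R - log2 (n.+1%:R : R))].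
Proof.
split=> [||/s_R_even|n n3]; last 2 first.
- exact.
- split; last exact: s_R_floor.
  (* Here [n - (n - 2) = 2] is even, so the parity argument applies. *)
  by apply/esym/s_R_even; [lia|rewrite subKn //; lia].
- by split; [rewrite s_R_ge1 // s_R_le|exact: s_R_eqP].
- split=> [p' /andP[]|m']; first exact: s_R_mono_p.
  exact: s_R_anti_m.
Qed.
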